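(* Let $S$ be a finite subdirectly irreducible member of $\mathsf V(S_7)$. Then exactly one of the following holds: (1) $S$ is isomorphic to $M_2$; (2) $S$ contains a subsemiring isomorphic to $S_7$ (and hence $\mathsf V(S)=\mathsf V(S_7)$); (3) $S$ is isomorphic to $S_{\mathscr F}$ for some partition system $\mathscr F$. Moreover, in case (2), $S$ is isomorphic to $S_{\mathscr F}^1$ for some partition system $\mathscr F$.
   Context: $S_7$ is the ai-semiring on $\{\infty,a,1\}$ with $x+x=x$, $x+y=\infty$ for $x\neq y$, and commutative multiplication with $\infty$ a zero, $a\cdot a=\infty$, $a\cdot 1=a$, $1\cdot1=1$. $M_2$ is the two-element ai-semiring $\{1,\infty\}$ with flat addition, $1\cdot1=1$, $\infty$ a multiplicative zero. For a finite nonempty set $I$ and a family $\mathscr F$ of nonempty subsets of $I$, the hypergraph $\mathbb H_{\mathscr F}$ has vertex set $\mathscr F$ and hyperedges all sets $\{A_1,\dots,A_k\}\subseteq\mathscr F$ of pairwise disjoint members with union $I$. $\mathscr F$ is a partition system if (Ha) every $A\in\mathscr F$ lies in some hyperedge of $\mathbb H_{\mathscr F}$ and (Hb) no member of $\mathscr F$ is a disjoint union of a set of smaller members of $\mathscr F$. Let $\overline{\mathscr F}$ be the set of all unions $A_1\cup\dots\cup A_k$ where $\{A_1,\dots,A_k\}$ is a subset of a hyperedge of $\mathbb H_{\mathscr F}$. The semiring $S_{\mathscr F}$ has universe $\overline{\mathscr F}\cup\{\infty\}$, flat addition ($x+x=x$, $x+y=\infty$ for $x\neq y$), $\infty$ a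 multiplicative zero, and for $A,B\in\overline{\mathscr F}$: $A\cdot B=A\cup B$ if $A\cap B=\varnothing$ and $A\cup B\in\overline{\mathscr F}$, and $A\cdot B=\infty$ otherwise. $S^1_{\mathscr F}$ denotes $S_{\mathscr F}$ with a new element $1$ adjoined that is a multiplicative identity, with $1+1=1$ and $1+x=\infty$ for $x\neq1$. *)

(* Defs.v *)
From mathcomp Require Import all_boot.
Set Implicit Arguments. Unset Strict Implicit. Unset Printing Implicit Defensive.

Inductive term : Type :=
  | TVar of nat
  | TAdd of term & term
  | TMul of term & term.

Fixpoint teval (U : Type) (add mul : U -> U -> U) (v : nat -> U) (t : term) : U :=
  match t with
  | TVar i => v i
  | TAdd s u => add (teval add mul v s) (teval add mul v u)
  | TMul s u => mul (teval add mul v s) (teval add mul v u)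
  end.

Definition satisfies (U : Type) (add mul : U -> U -> U) (s t : term) : Prop :=
  forall v : nat -> U, teval add mul v s = teval add mul v t.

Inductive s7 : Type := S7inf | S7a | S7one.

Definition s7_add (x y : s7) : s7 :=
  match x, y with
  | S7inf, S7inf => S7inf
  | S7a, S7a => S7a
  | S7one, S7one => S7one
  | _, _ => S7inf
  end.

Definition s7_mul (x y : s7) : s7 :=
  match x, y with
  | S7inf, _ => S7inf
  | _, S7inf => S7inf
  | S7a, S7a => S7inf
  | S7a, S7one => S7a
  | S7one, S7a => S7a
  | S7one, S7one => S7one
  end.

(* Membership in V(S_7): by Birkhoff's theorem, V(S_7) is the class of
   algebras of type (2,2) satisfying every identity satisfied by S_7. *)
Definition in_V_S7 (T : Type) (add mul : T -> T -> T) : Prop :=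
  forall s t : term, satisfies s7_add s7_mul s t -> satisfies add mul s t.

Inductive m2 : Type := M2one | M2inf.

Definition m2_add (x y : m2) : m2 :=
  match x, y with
  | M2one, M2one => M2one
  | M2inf, M2inf => M2inf
  | _, _ => M2inf
  end.

Definition m2_mul (x y : m2) : m2 :=
  match x, y with
  | M2one, M2one => M2one
  | _, _ => M2inf
  end.

Definition congruence (T : Type) (add mul : T -> T -> T) (th : T -> T -> Prop) :=
  [/\ (forall x, th x x),
      (forall x y, th x y -> th y x),
      (forall x y z, th x y -> th y z -> th x z),
      (forall x y x' y', th x x' -> th y y' -> th (add x y) (add x' y')) &
      (forall x y x' y', th x x' -> th y y' -> th (mul x y) (mul x' y'))].

Definition subdirectly_irreducible (T : Type) (add mul : T -> T -> T) : Prop :=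
  exists a b : T, a <> b /\
    forall th, congruence add mul th ->
      (exists x y, x <> y /\ th x y) -> th a b.

Definition is_hom (T U : Type) (addT mulT : T -> T -> T) (addU mulU : U -> U -> U)
  (f : T -> U) : Prop :=
  (forall x y, f (addT x y) = addU (f x) (f y)) /\
  (forall x y, f (mulT x y) = mulU (f x) (f y)).

(* (T,addT,mulT) is isomorphic to the algebra whose universe is the subset
   P of U (assumed closed) with the operations addU, mulU: there is a
   homomorphic bijection from T onto P. *)
Definition iso_onto (T U : Type) (addT mulT : T -> T -> T) (P : U -> Prop)
  (addU mulU : U -> U -> U) : Prop :=
  exists f : T -> U,
    [/\ injective f, (forall u, P u <-> exists x, f x = u) &
        is_hom addT mulT addU mulU f].

Definition has_sub_iso (T U : Type) (addT mulT : T -> T -> T) (addU mulU : U -> U -> U)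
  : Prop :=
  exists g : U -> T, injective g /\ is_hom addU mulU addT mulT g.

Section PartitionSystems.
Variable n : nat.
Implicit Types (F E P : {set {set 'I_n}}) (A B X : {set 'I_n}).

Definition pw_disjoint P : bool :=
  [forall A in P, forall B in P, (A != B) ==> [disjoint A & B]].

Definition bigunion P : {set 'I_n} := \bigcup_(B in P) B.

Definition hyperedge F E : bool :=
  [&& E \subset F, pw_disjoint E & bigunion E == setT].

Definition partition_system F : Prop :=
  [/\ (forall A, A \in F -> A != set0),
      (forall A, A \in F -> exists E, hyperedge F E && (A \in E)) &
      (forall A, A \in F -> forall P, P \subset F ->
          (forall B, B \in P -> B \proper A) -> pw_disjoint P ->
          bigunion P != A)].

Definition Fbar F X : bool :=
  [exists E : {set {set 'I_n}}, hyperedge F E &&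
     [exists P : {set {set 'I_n}}, [&& P \subset E, P != set0 & X == bigunion P]]].

End PartitionSystems.

Inductive sfe (n : nat) : Type :=
  | SFinf
  | SFset of {set 'I_n}
  | SFone.
Arguments SFinf {n}.
Arguments SFone {n}.

Definition sf_add (n : nat) (x y : sfe n) : sfe n :=
  match x, y with
  | SFinf, SFinf => SFinf
  | SFone, SFone => SFone
  | SFset A, SFset B => if A == B then SFset A else SFinf
  | _, _ => SFinf
  end.

Definition sf_mul (n : nat) (F : {set {set 'I_n}}) (x y : sfe n) : sfe n :=
  match x, y with
  | SFinf, _ => SFinf
  | _, SFinf => SFinf
  | SFone, z => z
  | z, SFone => z
  | SFset A, SFset B =>
      if [disjoint A & B] && Fbar F (A :|: B) then SFset (A :|: B) else SFinf
  end.

Definition in_SF (n : nat) (F : {set {set 'I_n}}) (x : sfe n) : Prop :=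
  match x with
  | SFinf => True
  | SFset A => Fbar F A
  | SFone => False
  end.

Definition in_SF1 (n : nat) (F : {set {set 'I_n}}) (x : sfe n) : Prop :=
  match x with
  | SFinf => True
  | SFset A => Fbar F A
  | SFone => True
  end.

Definition iso_SF (T : Type) (add mul : T -> T -> T) : Prop :=
  exists (n : nat) (F : {set {set 'I_n}}),
    0 < n /\ partition_system F /\ iso_onto add mul (in_SF F) (@sf_add n) (sf_mul F).

Definition iso_SF1 (T : Type) (add mul : T -> T -> T) : Prop :=
  exists (n : nat) (F : {set {set 'I_n}}),
    0 < n /\ partition_system F /\ iso_onto add mul (in_SF1 F) (@sf_add n) (sf_mul F).

Definition exactly_one3 (P1 P2 P3 : Prop) : Prop :=
  (P1 /\ ~ P2 /\ ~ P3) \/ (~ P1 /\ P2 /\ ~ P3) \/ (~ P1 /\ ~ P2 /\ P3).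

(* Main.v *)
(** Since [S] is subdirectly irreducible, the syntactic congruence of some
    down-set [{x | x <= c}] is trivial.  The identities of [S_7] then make [S]
    flat and 0-cancellative, and every nonzero ([<> inf]) element divides [c].
    Let [I] be the set of maps [phi] from the nonzero elements to [{1, a}] that
    preserve nonzero products and send [c] to [a], and put
    [A_x = {phi in I | phi x = a}].  Then [A_(xy) = A_x + A_y] (disjoint union)
    when [xy] is nonzero, and [A_c = I].  Conversely, if [A_x1, .., A_xk]
    partition [I], then the multiplication table of [S] turns the equation
    [x1 .. xk = c] into an identity of [S_7], so it holds in [S].  Hence
    [x |-> A_x] is injective, only an identity element can have [A_x] empty, and
    the nonempty [A_x] form the closure of the partition system of those [A_x]
    that do not split into two others. *)
Require Import Defs.
From mathcomp Require Import all_boot.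
Set Implicit Arguments. Unset Strict Implicit. Unset Printing Implicit Defensive.

(** * Irreducible members of a set family and the partition system they form *)

Section IrreducibleMembers.
Variables (n : nat) (G : {set {set 'I_n}}).
Hypothesis G_neq0 : set0 \notin G.
Hypothesis G_compl : forall B, B \in G -> B = setT \/ ~: B \in G.
Hypothesis G_subcover : forall P Q : {set {set 'I_n}}, P \subset G -> trivIset P ->
  cover P = setT -> Q \subset P -> Q != set0 -> cover Q \in G.

(** Only splittings into two members are excluded; the closure properties of [G] then exclude longer
    disjoint decompositions too. *)
Definition irreducibles : {set {set 'I_n}} :=
  [set B in G | [forall C, (C \in G) && (C \proper B) ==> (B :\: C \notin G)]].

Lemma pw_disjointE (P : {set {set 'I_n}}) : pw_disjoint P = trivIset P.
Proof.
apply/idP/trivIsetP => [/forall_inP H A B AP BP AB|H].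
  by have /forall_inP/(_ B BP)/implyP/(_ AB) := H A AP.
apply/forall_inP => A AP; apply/forall_inP => B BP; apply/implyP; exact: H.
Qed.

Lemma cover_setU (P Q : {set {set 'I_n}}) : cover (P :|: Q) = cover P :|: cover Q.
Proof. exact: bigcup_setU. Qed.

Lemma irreducibles_sub : irreducibles \subset G.
Proof. by apply/subsetP => B; rewrite inE => /andP[]. Qed.

(** Induction on the cardinality of [B]: a reducible [B] splits into [C] and [B :\: C], both
    strictly smaller since members of [G] are nonempty, and their decompositions are joined. *)
Lemma irreducible_decomposition B : B \in G ->
  exists2 P : {set {set 'I_n}}, P \subset irreducibles & trivIset P /\ cover P = B.
Proof.
have [m] := ubnP #|B|; elim: m B => // m IH B; rewrite ltnS => Bm BG.
have [Bi|] := boolP (B \in irreducibles).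
  exists [set B]; first by rewrite sub1set.
  by split; [exact: trivIset1 | rewrite /cover big_set1].
rewrite inE BG /= negb_forall => /existsP[C].
rewrite negb_imply negbK => /andP[/andP[CG CB] DG].
have C0 : C != set0 by apply: contraNneq G_neq0 => <-.
have [|P Pi [tP cP]] := IH C _ CG.
  exact: leq_trans (proper_card CB) Bm.
have DB : B :\: C \proper B.
  rewrite properE subsetDl /=; apply/subsetPn.
  have /set0Pn[x xC] := C0; exists x; first by rewrite (subsetP (proper_sub CB)).
  by rewrite inE xC.
have [|Q Qi [tQ cQ]] := IH (B :\: C) _ DG.
  exact: leq_trans (proper_card DB) Bm.
exists (P :|: Q); first by rewrite subUset Pi.
split; last by rewrite cover_setU cP cQ -{1}(setIidPr (proper_sub CB)) setID.
apply: trivIsetU => //.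
by rewrite cP cQ -setI_eq0 setIDA setIC -setIDA setDv setI0.
Qed.

(** The complement of [cover P] is empty or a member of [G]; decomposing it supplies the missing
    blocks. *)
Lemma irreducible_completion (P : {set {set 'I_n}}) :
    P \subset irreducibles -> trivIset P -> cover P \in G ->
  exists2 E, hyperedge irreducibles E & P \subset E.
Proof.
move=> Pi tP cG.
have [Q Qi [tQ cQ]] : exists2 Q : {set {set 'I_n}},
    Q \subset irreducibles & trivIset Q /\ cover Q = ~: cover P.
  have [->|/irreducible_decomposition //] := G_compl cG.
  exists set0; first exact: sub0set.
  by rewrite /trivIset /cover !big_set0 cards0 setCT.
exists (P :|: Q); last exact: subsetUl.
apply/and3P; split; first by rewrite subUset Pi.
  rewrite pw_disjointE; apply: trivIsetU => //.
  by rewrite cQ -setI_eq0 setICr.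
by rewrite -[bigunion _]/(cover _) cover_setU cQ setUCr.
Qed.

Lemma cover_hyperedge_sub (E P : {set {set 'I_n}}) :
  hyperedge irreducibles E -> P \subset E -> P != set0 -> cover P \in G.
Proof.
move=> /and3P[Ei tE /eqP cE]; apply: G_subcover => //.
- exact: subset_trans Ei irreducibles_sub.
- by rewrite -pw_disjointE.
Qed.

(** For the last clause: if [P] splits [A] and [B \in P], complete [P] to a hyperedge. The union of
    the blocks of [P] other than [B] is [A :\: B] and lies in [G], so [A] is reducible. *)
Lemma partition_system_irreducibles : partition_system irreducibles.
Proof.
split=> [A|A Ai|A Ai P Pi Pprop].
- by move=> /(subsetP irreducibles_sub) AG; apply: contraNneq G_neq0 => <-.
- have [|||E hE sE] := @irreducible_completion [set A].
  + by rewrite sub1set.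
  + exact: trivIset1.
  + by rewrite /cover big_set1 (subsetP irreducibles_sub).
  by exists E; rewrite hE (subsetP sE) // set11.
rewrite pw_disjointE -[bigunion _]/(cover _) => tP; apply/eqP => cP.
have AG := subsetP irreducibles_sub A Ai.
have [|E hE sE] := irreducible_completion Pi tP; first by rewrite cP.
have /set0Pn[B BP] : P != set0.
  apply: contraNneq G_neq0 => P0.
  by move: AG; rewrite -cP P0 /cover big_set0.
have BA := Pprop B BP.
move: Ai; rewrite inE AG => /forallP/(_ B).
rewrite BA (subsetP irreducibles_sub) ?(subsetP Pi) //= => /negP; case.
have cPB : cover (P :\ B) = A :\: B by rewrite coverD1 // cP.
rewrite -cPB; apply: cover_hyperedge_sub hE _ _.
  exact: subset_trans (subsetDl _ _) sE.
(* Were [B] the only block, [A] would be contained in its proper subset [B]. *)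
apply/eqP => PB0; move: cPB; rewrite PB0 /cover big_set0 => /esym/eqP.
by rewrite setD_eq0 => AB; have := proper_sub_trans BA AB; rewrite properxx.
Qed.

Lemma Fbar_irreducibles X : Fbar irreducibles X = (X \in G).
Proof.
apply/existsP/idP => [[E /andP[hE /existsP[P /and3P[PE P0 /eqP->]]]]|XG].
  exact: cover_hyperedge_sub hE PE P0.
have [P Pi [tP cP]] := irreducible_decomposition XG.
have [|E hE sE] := irreducible_completion Pi tP; first by rewrite cP.
exists E; rewrite hE; apply/existsP; exists P.
rewrite sE -cP eqxx andbT; apply: contraNneq G_neq0 => P0.
by move: XG; rewrite -cP P0 /cover big_set0.
Qed.

End IrreducibleMembers.

(** * Identities of [S_7], syntactic congruences and flatness *)

Section Flatness.
Variables (T : finType) (add mul : T -> T -> T).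
Hypothesis HV : in_V_S7 add mul.

Let V0 := TVar 0.
Let V1 := TVar 1.
Let V2 := TVar 2.
Let V3 := TVar 3.

(** The law is checked on all valuations in [S_7] and transferred as an identity; [nth x
    [:: x; y; z]] is the valuation giving the variables the intended values. *)
Lemma V_addA : associative add.
Proof.
move=> x y z; apply: (HV (s := TAdd V0 (TAdd V1 V2)) (t := TAdd (TAdd V0 V1) V2) _
  (nth x [:: x; y; z])) => v /=.
by case: (v 0); case: (v 1); case: (v 2).
Qed.

Lemma V_addC : commutative add.
Proof.
move=> x y; apply: (HV (s := TAdd V0 V1) (t := TAdd V1 V0) _ (nth x [:: x; y])) => v /=.
by case: (v 0); case: (v 1).
Qed.

Lemma V_addxx : idempotent_op add.
Proof.
move=> x; apply: (HV (s := TAdd V0 V0) (t := V0) _ (fun _ => x)) => v /=.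
by case: (v 0).
Qed.

Lemma V_mulA : associative mul.
Proof.
move=> x y z; apply: (HV (s := TMul V0 (TMul V1 V2)) (t := TMul (TMul V0 V1) V2) _
  (nth x [:: x; y; z])) => v /=.
by case: (v 0); case: (v 1); case: (v 2).
Qed.

Lemma V_mulC : commutative mul.
Proof.
move=> x y; apply: (HV (s := TMul V0 V1) (t := TMul V1 V0) _ (nth x [:: x; y])) => v /=.
by case: (v 0); case: (v 1).
Qed.

Lemma V_mulDl : left_distributive mul add.
Proof.
move=> x y z; apply: (HV (s := TMul (TAdd V0 V1) V2)
  (t := TAdd (TMul V0 V2) (TMul V1 V2)) _ (nth x [:: x; y; z])) => v /=.
by case: (v 0); case: (v 1); case: (v 2).
Qed.

(** [None] acts as an adjoined identity, so [ract x o] runs over [x] and all its multiples. *)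
Definition ract x (o : option T) := if o is Some r then mul x r else x.

(* 0-cancellativity of [S_7], read as an identity: if [xp] and [yp] have a common
   value then [x = y], hence [xq = yq]. *)
Lemma V_cancel x y p q :
  let u := add (add (ract x p) (ract y p)) (ract x q) in add u (ract y q) = u.
Proof.
pose tract t (o : option T) k := if o is Some _ then TMul t (TVar k) else t.
pose u := TAdd (TAdd (tract V0 p 2) (tract V1 p 2)) (tract V0 q 3).
(* The value at [None] is arbitrary, since the corresponding variable then does not occur. *)
pose val o := if o is Some r then r else x.
have /(_ (nth x [:: x; y; val p; val q])) : satisfies add mul (TAdd u (tract V1 q 3)) u.
  apply: HV => v; rewrite /u /tract.
  case: p {u} => [?|]; case: q => [?|] /=;
  by case: (v 0); case: (v 1); case: (v 2); case: (v 3).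
by rewrite /u; case: p {u} => [?|]; case: q => [?|].
Qed.

Definition le x y := add x y == y.

Lemma le_addl x y z : le (add x y) z = le x z && le y z.
Proof.
apply/eqP/andP => [xyz|[/eqP xz /eqP yz]]; last by rewrite -V_addA yz.
rewrite /le -xyz; split; apply/eqP; first by rewrite !V_addA V_addxx.
by rewrite [add x y]V_addC V_addA V_addA V_addxx.
Qed.

Lemma le_refl x : le x x.
Proof. by rewrite /le V_addxx. Qed.

(** Multiplicative translations suffice to test membership in the down-set of [c], because a sum is
    below [c] exactly when both summands are. *)
Definition syntactic c x y := [forall o, le (ract x o) c == le (ract y o) c].

Lemma syntacticP c x y :
  reflect (forall o, le (ract x o) c = le (ract y o) c) (syntactic c x y).
Proof. exact: 'forall_eqP. Qed.

Lemma ract_add x y o : ract (add x y) o = add (ract x o) (ract y o).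
Proof. by case: o => //= r; rewrite V_mulDl. Qed.

Lemma ract_mul x y o : ract (mul x y) o = mul x (ract y o).
Proof. by case: o => //= r; rewrite V_mulA. Qed.

Lemma syntactic_congruence c : congruence add mul (syntactic c).
Proof.
have mull x x' y : syntactic c x x' -> syntactic c (mul x y) (mul x' y).
  move=> /syntacticP H; apply/syntacticP => o.
  by rewrite !ract_mul; exact: (H (Some (ract y o))).
split=> [x|x y|x y z|x y x' y'|x y x' y'].
- exact/syntacticP.
- by move=> /syntacticP H; apply/syntacticP => o.
- by move=> /syntacticP H /syntacticP K; apply/syntacticP => o; rewrite H K.
- move=> /syntacticP H /syntacticP K; apply/syntacticP => o.
  by rewrite !ract_add !le_addl H K.
- move=> /(mull _ _ y)/syntacticP H /(mull _ _ x')/syntacticP K.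
  by apply/syntacticP => o; rewrite H V_mulC K V_mulC.
Qed.

(** Let [a], [b] be identified by every nontrivial congruence. If the syntactic congruences of [a]
    and of [b] were both nontrivial, testing with [None] would give [b <= a] and [a <= b]. *)
Lemma trivial_syntactic : subdirectly_irreducible add mul ->
  exists c, (forall x y, syntactic c x y -> x = y) /\ exists d, c <> d.
Proof.
move=> [a [b [ab mono]]].
have dec c : (forall x y, syntactic c x y -> x = y) \/ syntactic c a b.
  have [/existsP[x /existsP[y /andP[/eqP xy sxy]]]|] :=
    boolP [exists x, exists y, (x != y) && syntactic c x y].
    by right; apply: (mono _ (syntactic_congruence c)); exists x, y.
  rewrite negb_exists => /forallP H; left => x y sxy; apply/eqP.
  by apply: contraT => xy; have /existsP[] := H x; exists y; rewrite xy.
have [Ha|/syntacticP/(_ None)/= sa] := dec a; first by exists a; split; last by exists b.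
have [Hb|/syntacticP/(_ None)/= sb] := dec b.
  by exists b; split; last by exists a => /esym.
move: sa sb; rewrite !le_refl => /esym/eqP ba /eqP; rewrite V_addC ba => ab'.
by case: ab.
Qed.

(* The top element is the common value of all sums of two distinct elements: by
   [V_cancel] no multiple of such a sum is below [c]. *)
Lemma flat_structure : subdirectly_irreducible add mul ->
  exists c inf : T, [/\ c != inf, forall x y, x != y -> add x y = inf,
    forall x, mul inf x = inf &
    forall x, x != inf -> x = c \/ exists r, mul x r = c].
Proof.
move=> /trivial_syntactic[c [triv [d cd]]].
have nodiv x y o : x <> y -> ~~ le (ract (add x y) o) c.
  move=> xy; apply/negP; rewrite ract_add le_addl => /andP[xo yo].
  apply: xy; apply: triv; apply/syntacticP => q.
  have imp u w : le (ract u o) c -> le (ract w o) c -> le (ract u q) c -> le (ract w q) c.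
    move=> uo wo uq; have := V_cancel u w o q => /= E.
    have : le (add (add (ract u o) (ract w o)) (ract u q)) c by rewrite !le_addl uo wo.
    by rewrite -E le_addl => /andP[].
  by apply/idP/idP; apply: imp.
pose inf := add c d.
(* All elements without a multiple below [c] are syntactically equivalent, hence equal; [inf] is one
   of them, being a sum of distinct elements. *)
have infP x : (forall o, ~~ le (ract x o) c) -> x = inf.
  move=> H; apply: triv; apply/syntacticP => o.
  by rewrite (negbTE (H o)) (negbTE (nodiv _ _ o cd)).
have ninf o : ~~ le (ract inf o) c by exact: nodiv.
exists c, inf; split.
- by apply/eqP => ci; have := ninf None; rewrite -ci /= le_refl.
- by move=> x y /eqP xy; apply: infP => o; exact: nodiv.
- by move=> x; apply: infP => o; rewrite ract_mul; exact: (ninf (Some _)).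
move=> x xinf.
have [/existsP[o]|] := boolP [exists o, le (ract x o) c]; last first.
  by rewrite negb_exists => /forallP H; case/eqP: xinf; exact: infP.
(* [c] is minimal: otherwise [add y c] would be a sum of distinct elements below [c]. *)
have leE y : le y c -> y = c.
  move=> yc; have [//|/eqP ync] := eqVneq y c.
  by have := nodiv _ _ None ync; rewrite /= le_addl yc le_refl.
by case: o => [r|] /leE; [right; exists r | left].
Qed.

End Flatness.

(** * Cancellation, entailment between product equations, and characters *)

Section Characters.
Variables (T : finType) (add mul : T -> T -> T).
Hypothesis HV : in_V_S7 add mul.
Variables c inf : T.
Hypothesis c_neq_inf : c != inf.
Hypothesis add_flat : forall x y, x != y -> add x y = inf.
Hypothesis mul_inf : forall x, mul inf x = inf.
Hypothesis divides_c : forall x, x != inf -> x = c \/ exists r, mul x r = c.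

(** If [x] and [y] differed, then [xr = xr + yr = (x + y)r = inf]. *)
Lemma mul0cancel x y r : mul x r = mul y r -> mul x r != inf -> x = y.
Proof.
move=> E xr; apply: contraNeq xr => /add_flat xy.
by rewrite -[mul x r](V_addxx HV) {2}E -(V_mulDl HV) xy mul_inf.
Qed.

Lemma mul_neq_inf x y : mul x y != inf -> x != inf /\ y != inf.
Proof.
move=> xy; split; apply: contraNneq xy => ->; first by rewrite mul_inf.
by rewrite (V_mulC HV) mul_inf.
Qed.

Lemma teval_foldl (U : Type) (addU mulU : U -> U -> U) (v : nat -> U)
    (op : term -> term -> term) (opU : U -> U -> U) (W : Type) (f : W -> term) t ws :
    (forall s t, teval addU mulU v (op s t) = opU (teval addU mulU v s) (teval addU mulU v t)) ->
  teval addU mulU v (foldl op t (map f ws))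
  = foldl opU (teval addU mulU v t) (map (fun w => teval addU mulU v (f w)) ws).
Proof. by move=> H; elim: ws t => //= w ws IH t; rewrite IH H. Qed.

Lemma foldl_s7_add (W : eqType) (f : W -> s7) d (ws : seq W) :
  foldl s7_add d (map f ws) = S7inf \/
  foldl s7_add d (map f ws) = d /\ {in ws, forall w, f w = d}.
Proof.
elim: ws d => [|w ws IH] d /=; first by right.
have [->|[-> H]] := IH (s7_add d (f w)); first by left.
have [->|[-> E]] : s7_add d (f w) = S7inf \/ s7_add d (f w) = d /\ f w = d.
- by case: d {H} => //; case: (f w) => /=; auto.
- by left.
right; split=> // w'; rewrite inE => /predU1P[->//|w'ws].
by rewrite H // E; case: (d).
Qed.

(* An implication between equations [w = c] valid in the nonzero part of [S_7]
   yields the identity [c + w1 + .. + wk = c + w1 + .. + wk + w]. *)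
Lemma word_entailment (ws : seq (T * seq T)) x s :
    {in ws, forall w, foldl mul w.1 w.2 = c} ->
    (forall v : T -> s7, v c <> S7inf ->
       {in ws, forall w, foldl s7_mul (v w.1) (map v w.2) = v c} ->
       foldl s7_mul (v x) (map v s) = v c) ->
  foldl mul x s = c.
Proof.
move=> Hws ent.
(* Every element of [T] becomes a variable, numbered by its rank, so that [nth c (enum T)] sends
   each variable back to its element. *)
pose X (y : T) := TVar (enum_rank y).
pose tw (w : T * seq T) := foldl TMul (X w.1) (map X w.2).
pose t := foldl TAdd (X c) (map tw ws).
have /(_ (nth c (enum T))) : satisfies add mul t (TAdd t (tw (x, s))).
  apply: HV => v; pose u (y : T) := v (enum_rank y).
  have twE w : teval s7_add s7_mul v (tw w) = foldl s7_mul (u w.1) (map u w.2).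
    by rewrite /tw (teval_foldl (opU := s7_mul)).
  rewrite /= twE /t (teval_foldl (opU := s7_add)) //=.
  have [->|[-> H]] := foldl_s7_add
    (fun w => teval s7_add s7_mul v (tw w)) (u c) ws; first by case: (foldl _ _ _).
  have [->|uc] : u c = S7inf \/ u c <> S7inf by case: (u c); [left | right | right].
    by case: (foldl _ _ _).
  rewrite (ent u) //; first by case: (u c).
  by move=> w /H; rewrite twE.
have twE w : teval add mul (nth c (enum T)) (tw w) = foldl mul w.1 w.2.
  rewrite /tw (teval_foldl (opU := mul)) //= nth_enum_rank.
  by rewrite (eq_map (nth_enum_rank c)) map_id.
rewrite /= twE /t (teval_foldl (opU := add)) //= nth_enum_rank.
have -> : foldl add c (map (fun w => teval add mul (nth c (enum T)) (tw w)) ws) = c.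
  elim: ws Hws {ent t} => //= w ws IH H.
  rewrite twE H ?mem_head // (V_addxx HV) IH // => w' w's.
  by apply: H; rewrite inE w's orbT.
move=> E; apply/eqP; apply: contraT; rewrite eq_sym => /add_flat E'.
by move: c_neq_inf; rewrite E E' eqxx.
Qed.

(** [true] encodes the value [a] and [false] the value 1. The last conjunct forbids two factors [a],
    whose product in [S_7] is infinite. *)
Definition is_char (phi : {ffun T -> bool}) :=
  phi c && [forall x, forall y, (mul x y != inf) ==>
    (phi (mul x y) == phi x || phi y) && ~~ (phi x && phi y)].

Lemma is_charP phi : is_char phi -> phi c /\ forall x y, mul x y != inf ->
  phi (mul x y) = phi x || phi y /\ ~~ (phi x && phi y).
Proof.
move=> /andP[-> /forallP H]; split=> // x y xy.
by have /forallP/(_ y)/implyP/(_ xy)/andP[/eqP] := H x.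
Qed.

Lemma foldl_s7_mul_count (v : T -> s7) (phi : pred T) x s :
    {in x :: s, forall y, v y = if phi y then S7a else S7one} ->
    count phi (x :: s) = 1 ->
  foldl s7_mul (v x) (map v s) = S7a.
Proof.
(* [f k] is the [k]-th power of [a] in [S_7]. *)
pose f k := match k with 0 => S7one | 1 => S7a | _ => S7inf end.
have f_add k y : s7_mul (f k) (if phi y then S7a else S7one) = f (k + phi y).
  by case: (phi y); case: k => [|[|k]] //=; rewrite addn0.
have gen k r : {in r, forall y, v y = if phi y then S7a else S7one} ->
    foldl s7_mul (f k) (map v r) = f (k + count phi r).
  elim: r k => [|y r IH] k H /=; first by rewrite addn0.
  rewrite H ?mem_head // f_add IH ?addnA // => z zr.
  by apply: H; rewrite inE zr orbT.
move=> H cnt; have := gen 0 (x :: s) H.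
by rewrite /= in cnt *; rewrite cnt /=; case: (v x).
Qed.

(** The premises of the entailment are all equations stating that a product of two or three elements
    is [c]. A valuation satisfying them with [v c] finite has finite values on all nonzero elements,
    as these divide [c]. If [v c] is 1, all these values are 1; if it is [a], the valuation gives a
    character, and the product has exactly one factor [a]. *)
Lemma product_eq_c x s : all (fun y => y != inf) (x :: s) ->
    (forall phi, is_char phi -> count phi (x :: s) = 1) ->
  foldl mul x s = c.
Proof.
move=> /allP nz cnt.
pose ws2 := [seq (p.1, [:: p.2]) | p <- enum {: T * T} & mul p.1 p.2 == c].
pose ws3 := [seq (p.1.1, [:: p.1.2; p.2]) | p <- enum {: T * T * T} &
  mul (mul p.1.1 p.1.2) p.2 == c].
apply: (word_entailment (ws := ws2 ++ ws3)).
  move=> w; rewrite mem_cat => /orP[] /mapP[p]; rewrite mem_filter => /andP[/eqP E _] -> //.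
move=> v vc H.
have H2 y r : mul y r = c -> s7_mul (v y) (v r) = v c.
  move=> E; apply: (H (y, [:: r])); rewrite mem_cat; apply/orP; left.
  by apply/mapP; exists (y, r) => //; rewrite mem_filter /= E eqxx mem_enum.
have H3 y z r : mul (mul y z) r = c -> s7_mul (s7_mul (v y) (v z)) (v r) = v c.
  move=> E; apply: (H (y, [:: z; r])); rewrite mem_cat; apply/orP; right.
  by apply/mapP; exists (y, z, r) => //; rewrite mem_filter /= E eqxx mem_enum.
pose phi := [ffun y => if v y is S7a then true else false].
have vphi y : y != inf -> v y = if phi y then S7a else S7one.
  rewrite ffunE => /divides_c[-> |[r /H2]]; first by case: (v c) vc.
  by case: (v y) => //; case: (v c) vc.
have [vc1|vca] : v c = S7one \/ v c = S7a by case: (v c) vc; auto.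
  have v1 y : y != inf -> v y = S7one.
    move=> /divides_c[-> //|[r /H2]].
    by rewrite vc1; case: (v y); case: (v r).
  rewrite vc1 v1 ?nz ?mem_head //.
  have : {in s, forall y, v y = S7one}.
    by move=> y ys; apply/v1/nz; rewrite inE ys orbT.
  elim: s {nz cnt} => //= y s IH K; rewrite K ?mem_head //= IH // => z zs.
  by apply: K; rewrite inE zs orbT.
rewrite vca; apply: (foldl_s7_mul_count (phi := phi)).
  by move=> y /nz /vphi.
apply: cnt; apply/andP; split; first by rewrite ffunE vca.
apply/forallP => y; apply/forallP => z; apply/implyP => yz.
have [y0 z0] := mul_neq_inf yz.
(* If [mul y z] is not [c] itself, it has a cofactor [r]. The two- and three-factor premises give
   both sides the same product [a] with [v r], and [v r] cancels in [S_7]. *)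
have : s7_mul (v y) (v z) = v (mul y z).
  have [E|[r E]] := divides_c yz; first by rewrite H2 E.
  move: (H3 _ _ _ E) (H2 _ _ E); rewrite vca (vphi y y0) (vphi z z0).
  rewrite (vphi _ yz).
  by case: (phi y); case: (phi z); case: (phi (mul y z)); case: (v r).
rewrite (vphi y y0) (vphi z z0) (vphi _ yz).
by case: (phi y); case: (phi z); case: (phi (mul y z)).
Qed.

(** * Sets of characters attached to elements *)

Definition chars : {set {ffun T -> bool}} := [set phi | is_char phi].

(** Characters are replaced by their indices because partition systems live on ['I_n]. *)
Definition char_set x : {set 'I_#|chars|} :=
  [set i | (enum_val i : {ffun T -> bool}) x].

Lemma char_set_mul x y : mul x y != inf ->
  char_set (mul x y) = char_set x :|: char_set y /\ [disjoint char_set x & char_set y].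
Proof.
move=> xy.
have chP (i : 'I_#|chars|) : is_char (enum_val i) by have := enum_valP i; rewrite inE.
split; first by apply/setP => i; rewrite !inE; have [_ /(_ _ _ xy)[->]] := is_charP (chP i).
rewrite -setI_eq0; apply/eqP/setP => i; rewrite !inE.
by have [_ /(_ _ _ xy)[_ /negbTE]] := is_charP (chP i).
Qed.

Lemma char_set_c : char_set c = setT.
Proof.
apply/setP => i; rewrite !inE.
by have := enum_valP i; rewrite inE => /is_charP[].
Qed.

Lemma foldl_mul_neq_inf x s : foldl mul x s != inf -> x != inf.
Proof. by elim: s x => //= y s IH x /IH /mul_neq_inf[]. Qed.

Lemma char_set_foldl x s : foldl mul x s != inf ->
  char_set (foldl mul x s) = \bigcup_(y <- x :: s) char_set y.
Proof.
elim: s x => [|y s IH] x /=; first by rewrite big_seq1.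
move=> H; rewrite IH // !big_cons setUA.
by have [-> _] := char_set_mul (foldl_mul_neq_inf H).
Qed.

Lemma char_set_product x s : all (fun y => y != inf) (x :: s) ->
    (forall i, count (fun y => i \in char_set y) (x :: s) = 1) ->
  foldl mul x s = c.
Proof.
move=> nz cnt; apply: product_eq_c => // phi phiP.
have phiC : phi \in chars by rewrite inE.
rewrite -(cnt (enum_rank_in phiC phi)); apply: eq_count => y.
by rewrite inE enum_rankK_in.
Qed.

(** Cofactors have complementary sets; the counting form matches the hypothesis of
    [char_set_product]. *)
Lemma divisor_count x r : mul x r = c ->
  forall i, (i \in char_set x) + (i \in char_set r) = 1.
Proof.
move=> xr i; have [|E D] := @char_set_mul x r; first by rewrite xr.
have : i \in char_set c by rewrite char_set_c inE.
rewrite -xr E in_setU; have [ix _|_ /= ->//] := boolP (i \in char_set x).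
by rewrite (disjointFr D).
Qed.

(** With a cofactor [r] of [z], the sets of [x], [y], [r] partition all characters, so
    [xyr = c = zr] and [r] cancels. *)
Lemma mul_char_set x y z : x != inf -> y != inf -> z != inf ->
  [disjoint char_set x & char_set y] -> char_set x :|: char_set y = char_set z ->
  mul x y = z.
Proof.
move=> x0 y0 z0 D E.
have cntE i : (i \in char_set x) + (i \in char_set y) = (i \in char_set z).
  rewrite -E in_setU; have [ix|//] := boolP (i \in char_set x).
  by rewrite (disjointFr D).
have [zc|[r zr]] := divides_c z0.
  rewrite zc; apply: (@char_set_product x [:: y]) => [|i]; first by rewrite /= x0 y0.
  by rewrite /= addn0 cntE zc char_set_c inE.
have r0 : r != inf by have [] := @mul_neq_inf z r; rewrite ?zr.
have xyr : mul (mul x y) r = c.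
  apply: (@char_set_product x [:: y; r]); first by rewrite /= x0 y0 r0.
  by move=> i /=; rewrite addn0 addnA cntE divisor_count.
by apply: (@mul0cancel _ _ r); rewrite xyr ?zr.
Qed.

Lemma char_set_eq0 e y : e != inf -> char_set e = set0 -> y != inf -> mul e y = y.
Proof.
move=> e0 e00 y0; apply: mul_char_set => //; rewrite e00 ?set0U //.
by rewrite -setI_eq0 set0I.
Qed.

(** A cofactor of [x] is also one of [y], since this can be read off from the sets; it then
    cancels. *)
Lemma char_set_inj x y : x != inf -> y != inf -> char_set x = char_set y -> x = y.
Proof.
move=> x0 y0 E; have [xc|[r xr]] := divides_c x0.
  rewrite xc; apply/esym; apply: (@char_set_product y [::]); first by rewrite /= y0.
  by move=> i; rewrite /= -E xc char_set_c inE.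
have r0 : r != inf by have [] := @mul_neq_inf x r; rewrite ?xr.
have yr : mul y r = c.
  apply: (@char_set_product y [:: r]); first by rewrite /= y0 r0.
  by move=> i /=; rewrite addn0 -E divisor_count.
by apply: (@mul0cancel _ _ r); rewrite xr ?yr.
Qed.

(** * Closure properties of the family of nonempty character sets *)

Definition char_sets := [set B | (B != set0) && [exists x, (x != inf) && (char_set x == B)]].

Lemma char_setsP B :
  reflect (B != set0 /\ exists2 x, x != inf & char_set x = B) (B \in char_sets).
Proof.
rewrite inE; apply: (iffP andP) => [[-> /existsP[x /andP[x0 /eqP <-]]]|[-> [x x0 <-]]].
  by split=> //; exists x.
by split=> //; apply/existsP; exists x; rewrite x0 eqxx.
Qed.

Lemma char_sets_neq0 : set0 \notin char_sets.
Proof. by rewrite inE eqxx. Qed.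

Lemma char_sets_compl B : B \in char_sets -> B = setT \/ ~: B \in char_sets.
Proof.
move=> /char_setsP[_ [x x0 <-]]; have [->|[r xr]] := divides_c x0.
  by left; rewrite char_set_c.
have r0 : r != inf by have [] := @mul_neq_inf x r; rewrite ?xr.
have E : ~: char_set x = char_set r.
  apply/setP => i; rewrite inE; have := divisor_count xr i.
  by case: (i \in _); case: (i \in _).
have [rE|rE] := eqVneq (char_set r) set0.
  by left; apply: setC_inj; rewrite E rE setCT.
by right; apply/char_setsP; rewrite E; split=> //; exists r.
Qed.

Lemma count_mem_partition (n : nat) (P : {set {set 'I_n}}) i :
  trivIset P -> cover P = setT -> count (fun B : {set 'I_n} => i \in B) (enum P) = 1.
Proof.
move=> tP cP; have iP : i \in cover P by rewrite cP inE.
rewrite -size_filter.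
rewrite (@perm_size _ _ [:: pblock P i]) //; apply: uniq_perm => //.
  exact/filter_uniq/enum_uniq.
move=> B; rewrite mem_filter mem_enum mem_seq1.
apply/andP/eqP => [[iB BP]|->]; first by rewrite (def_pblock tP BP iB).
by rewrite mem_pblock iP pblock_mem.
Qed.

(** Choose an element for each block of [P] and multiply, taking the blocks of [Q] first. The full
    product is [c], so the partial product over [Q] is nonzero, and its set is [cover Q]. *)
Lemma char_sets_subcover (P Q : {set {set 'I_#|chars|}}) :
  P \subset char_sets -> trivIset P -> cover P = setT -> Q \subset P -> Q != set0 ->
  cover Q \in char_sets.
Proof.
move=> PG tP cP QP Q0.
(* The default [c] keeps [el B] nonzero for every [B]. *)
pose el B := odflt c [pick x | (x != inf) && (char_set x == B)].
have el0 B : el B != inf by rewrite /el; case: pickP => //= x /andP[].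
have elK B : B \in P -> char_set (el B) = B.
  move=> /(subsetP PG)/char_setsP[_ [x x0 xB]]; rewrite /el.
  by case: pickP => [y /andP[_ /eqP]|/(_ x)] //=; rewrite x0 xB eqxx.
have perm : perm_eq (enum Q ++ enum (P :\: Q)) (enum P).
  apply: uniq_perm; rewrite ?enum_uniq // ?cat_uniq ?enum_uniq ?andbT /=.
    by apply/hasPn => B; rewrite !mem_enum inE => /andP[].
  move=> B; rewrite mem_cat !mem_enum inE.
  by have [/(subsetP QP) ->|] := boolP (B \in Q).
case EQ: (enum Q) => [|B0 q].
  by case/set0Pn: Q0 => B; rewrite -mem_enum EQ.
have elQ r : el B0 :: map el (q ++ r) = map el (enum Q ++ r) by rewrite EQ.
have prod_c : foldl mul (el B0) (map el (q ++ enum (P :\: Q))) = c.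
  apply: char_set_product => [|i].
    by rewrite elQ all_map; apply/allP => C _; exact: el0.
  rewrite elQ count_map -(count_mem_partition i tP cP) -(permP perm); apply: eq_in_count => C.
  by rewrite (perm_mem perm) mem_enum => /elK /= ->.
have z0 : foldl mul (el B0) (map el q) != inf.
  by move: c_neq_inf; rewrite -prod_c map_cat foldl_cat; exact: foldl_mul_neq_inf.
have cQ : char_set (foldl mul (el B0) (map el q)) = cover Q.
  rewrite char_set_foldl // -[q]cats0 elQ cats0 big_map big_enum /=.
  by apply: eq_bigr => C /(subsetP QP) /elK.
apply/char_setsP; split; last by exists (foldl mul (el B0) (map el q)).
have B0Q : B0 \in Q by rewrite -mem_enum EQ mem_head.
have /char_setsP[/set0Pn[i iB] _] := subsetP PG _ (subsetP QP _ B0Q).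
by apply/set0Pn; exists i; apply/bigcupP; exists B0.
Qed.

(** * The partition system and the representation of the semiring *)

Let F := irreducibles char_sets.

Lemma char_sets_system : partition_system F.
Proof.
apply: partition_system_irreducibles; [exact: char_sets_neq0 |
  exact: char_sets_compl | exact: char_sets_subcover].
Qed.

Lemma char_sets_Fbar X : Fbar F X = (X \in char_sets).
Proof.
apply: Fbar_irreducibles; [exact: char_sets_neq0 |
  exact: char_sets_compl | exact: char_sets_subcover].
Qed.

(** A nonzero element with empty set is an identity by [char_set_eq0], hence the value [SFone]. *)
Definition char_map x : sfe #|chars| :=
  if x == inf then SFinf else
  if char_set x == set0 then SFone else SFset (char_set x).

Lemma char_map_inj : injective char_map.
Proof.
move=> x y; rewrite /char_map.
have [->|x0] := eqVneq x inf; have [->|y0] := eqVneq y inf => //; do ?case: ifP => //.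
  by move=> /eqP yE /eqP xE _; apply: char_set_inj; rewrite ?yE.
by move=> _ _ []; exact: char_set_inj.
Qed.

Lemma sf_add_neq n (u v : sfe n) : u <> v -> sf_add u v = SFinf.
Proof.
case: u => [|A|]; case: v => [|B|] //= uv.
by case: eqP => // AB; case: uv; rewrite AB.
Qed.

Lemma sf_addxx n (u : sfe n) : sf_add u u = u.
Proof. by case: u => //= A; rewrite eqxx. Qed.

Lemma char_map_hom : is_hom add mul (@sf_add _) (sf_mul F) char_map.
Proof.
have fi : char_map inf = SFinf by rewrite /char_map eqxx.
split=> x y.
  have [->|xy] := eqVneq x y; first by rewrite (V_addxx HV) sf_addxx.
  by rewrite add_flat // sf_add_neq // => /char_map_inj; apply/eqP.
have [->|x0] := eqVneq x inf; first by rewrite mul_inf fi /=.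
have [->|y0] := eqVneq y inf.
  by rewrite (V_mulC HV) mul_inf fi; case: (char_map x).
have [xE|xE] := eqVneq (char_set x) set0.
  rewrite char_set_eq0 // {2}/char_map (negbTE x0) xE eqxx.
  by case: (char_map y).
have [yE|yE] := eqVneq (char_set y) set0.
  rewrite (V_mulC HV) char_set_eq0 // {3}/char_map (negbTE y0) yE eqxx.
  by case: (char_map x).
rewrite {2 3}/char_map (negbTE x0) (negbTE y0) (negbTE xE) (negbTE yE) /=.
rewrite char_sets_Fbar; have [xy|xy] := eqVneq (mul x y) inf.
  (* If the sets were disjoint with union in the family, that union would belong to some nonzero
     [z], and [mul_char_set] would force [mul x y = z]. *)
  rewrite xy fi; case: ifP => // /andP[D /char_setsP[_ [z z0 zE]]].
  by case/eqP: (z0); rewrite -(mul_char_set x0 y0 z0 D (esym zE)).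
have [E D] := char_set_mul xy.
have xyG : char_set (mul x y) \in char_sets.
  apply/char_setsP; split; last by exists (mul x y).
  by rewrite E setU_eq0 negb_and xE.
rewrite -E D xyG /char_map (negbTE xy); case: eqP => // E0.
by move: xyG; rewrite E0 (negbTE char_sets_neq0).
Qed.

Lemma chars_gt0 x : char_set x != set0 -> 0 < #|chars|.
Proof. by move=> /set0Pn[i _]; exact: leq_ltn_trans (ltn_ord i). Qed.

Lemma char_map_set X : Fbar F X <-> exists x, char_map x = SFset X.
Proof.
rewrite char_sets_Fbar /char_map; split.
  move=> /char_setsP[X0 [x x0 xX]]; exists x.
  by rewrite (negbTE x0) xX (negbTE X0).
move=> [x]; case: eqVneq => // x0; case: eqVneq => // X0 [<-].
by apply/char_setsP; split=> //; exists x.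
Qed.

(** * The three cases, according to which character sets are empty *)

Lemma iso_SF_chars : (forall x, x != inf -> char_set x != set0) -> iso_SF add mul.
Proof.
move=> H; exists #|chars|, F; split; first exact: chars_gt0 (H c c_neq_inf).
split; first exact: char_sets_system.
exists char_map; split; [exact: char_map_inj | | exact: char_map_hom].
case=> [|X|] /=; last 2 first.
- exact: char_map_set.
- split=> // -[x]; rewrite /char_map; case: eqVneq => // x0.
  by rewrite (negbTE (H _ x0)).
by split=> // _; exists inf; rewrite /char_map eqxx.
Qed.

Lemma iso_SF1_chars e x : e != inf -> char_set e = set0 -> char_set x != set0 ->
  iso_SF1 add mul.
Proof.
move=> e0 eE xE; exists #|chars|, F; split; first exact: chars_gt0 xE.
split; first exact: char_sets_system.
exists char_map; split; [exact: char_map_inj | | exact: char_map_hom].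
case=> [|X|] /=; last 2 first.
- exact: char_map_set.
- by split=> // _; exists e; rewrite /char_map (negbTE e0) eE eqxx.
by split=> // _; exists inf; rewrite /char_map eqxx.
Qed.

Lemma iso_M2_chars e : e != inf -> char_set e = set0 ->
    (forall x, x != inf -> char_set x = set0) ->
  iso_onto add mul (fun _ : m2 => True) m2_add m2_mul.
Proof.
move=> e0 eE H.
have xe x : x != inf -> x = e by move=> x0; apply: char_set_inj => //; rewrite eE H.
have fE x : x = inf \/ x = e by case: (eqVneq x inf) => [|/xe]; auto.
have infe : inf == e = false by apply: negbTE; rewrite eq_sym.
have addie : add inf e = inf by rewrite add_flat ?infe.
have addei : add e inf = inf by rewrite add_flat.
have mulei : mul e inf = inf by rewrite (V_mulC HV) mul_inf.
exists (fun x => if x == inf then M2inf else M2one); split.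
- by move=> x y; have [->|->] := fE x; have [->|->] := fE y; rewrite ?eqxx ?(negbTE e0).
- case; split=> // _; [exists e; rewrite (negbTE e0) | exists inf; rewrite eqxx] => //.
by split=> x y; have [->|->] := fE x; have [->|->] := fE y;
  rewrite ?addie ?addei ?mulei ?mul_inf ?(V_addxx HV) ?(char_set_eq0 e0) // ?eqxx ?(negbTE e0).
Qed.

(** A nonempty set is not disjoint from itself, so [mul x x = inf], while [e] is an identity; thus
    [inf], [x], [e] form a copy of [S_7]. *)
Lemma sub_S7_chars e x : e != inf -> char_set e = set0 ->
  x != inf -> char_set x != set0 -> has_sub_iso add mul s7_add s7_mul.
Proof.
move=> e0 eE x0 xE.
have ex : e != x by apply: contraNneq xE => <-; rewrite eE.
have xx : mul x x = inf.
  apply/eqP; apply: contraNT xE => /char_set_mul[_].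
  by rewrite -setI_eq0 setIid.
have mule y : y != inf -> mul e y = y by exact: char_set_eq0.
have inf_mul y : mul y inf = inf by rewrite (V_mulC HV) mul_inf.
have xe : mul x e = x by rewrite (V_mulC HV) mule.
exists (fun s => match s with S7inf => inf | S7a => x | S7one => e end); split.
  case; case=> // E; move: e0 x0 ex; by rewrite ?E ?eqxx // -E ?eqxx.
split; case; case=> /=; rewrite ?(V_addxx HV) ?mul_inf ?inf_mul ?xx ?xe ?mule //;
  by rewrite add_flat // eq_sym.
Qed.

Lemma chars_trichotomy :
  [\/ iso_onto add mul (fun _ : m2 => True) m2_add m2_mul,
      has_sub_iso add mul s7_add s7_mul /\ iso_SF1 add mul |
      iso_SF add mul].
Proof.
have [/existsP[e /andP[e0 /eqP eE]]|] :=
  boolP [exists e, (e != inf) && (char_set e == set0)]; last first.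
  rewrite negb_exists => /forallP H; apply/Or33/iso_SF_chars => x x0.
  by have := H x; rewrite x0.
have [/existsP[x /andP[x0 xE]]|] :=
  boolP [exists x, (x != inf) && (char_set x != set0)].
  by apply: Or32; split; [exact: sub_S7_chars e0 eE x0 xE | exact: iso_SF1_chars e0 eE xE].
rewrite negb_exists => /forallP H; apply/Or31/(iso_M2_chars e0 eE) => x x0.
by apply/eqP; have := H x; rewrite x0 negbK.
Qed.

End Characters.

(** * Mutual exclusion of the three cases *)

Lemma Fbar_set0 n (F : {set {set 'I_n}}) : partition_system F -> ~~ Fbar F set0.
Proof.
move=> [F0 _ _]; apply/negP => /existsP[E /andP[/and3P[EF _ _]]].
move=> /existsP[P /and3P[PE /set0Pn[B BP]]].
rewrite eq_sym -subset0 => /bigcupsP/(_ B BP); rewrite subset0 => B0.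
by have := F0 B (subsetP EF _ (subsetP PE _ BP)); rewrite B0.
Qed.

(** A nonempty set meets itself, so infinity is the only multiplicative idempotent of [S_F]. Both
    [M_2] and [S_7] have two, 1 and infinity, which separates them from the third case. *)
Lemma iso_SF_idempotent_eq (T : Type) (add mul : T -> T -> T) (x y : T) :
  iso_SF add mul -> mul x x = x -> mul y y = y -> x = y.
Proof.
move=> [n [F [_ [Fps [f [finj fim [_ fM]]]]]]].
have idem z : mul z z = z -> f z = SFinf.
  move=> zz; have := fM z z; rewrite zz.
  have : in_SF F (f z) by apply/fim; exists z.
  case: (f z) => //= A FA; case: ifP => // /andP[].
  by rewrite -setI_eq0 setIid => /eqP A0; move: FA; rewrite A0 (negbTE (Fbar_set0 Fps)).
by move=> /idem fx /idem fy; apply: finj; rewrite fx.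
Qed.

Theorem theorem4p4 (T : finType) (add mul : T -> T -> T) :
  in_V_S7 add mul ->
  subdirectly_irreducible add mul ->
  exactly_one3
    (iso_onto add mul (fun _ : m2 => True) m2_add m2_mul)
    (has_sub_iso add mul s7_add s7_mul)
    (iso_SF add mul)
  /\ (has_sub_iso add mul s7_add s7_mul -> iso_SF1 add mul).
Proof.
move=> HV SI.
(* By cardinality: three elements do not inject into two. *)
have M2_S7 : iso_onto add mul (fun _ : m2 => True) m2_add m2_mul ->
    ~ has_sub_iso add mul s7_add s7_mul.
  move=> [f [finj _ _]] [g [ginj _]].
  have inj : injective (f \o g) by exact: inj_comp.
  have := (inj S7inf S7a, inj S7inf S7one, inj S7a S7one) => /=.
  by case: (f (g S7inf)); case: (f (g S7a)); case: (f (g S7one)) => -[[A B] C];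
    first [have := A erefl | have := B erefl | have := C erefl].
have M2_SF : iso_onto add mul (fun _ : m2 => True) m2_add m2_mul -> ~ iso_SF add mul.
  move=> [f [finj fim [_ fM]]] SF.
  have [/(_ I)[x fx] _] := fim M2one; have [/(_ I)[y fy] _] := fim M2inf.
  suff xy : x = y by move: fx; rewrite xy fy.
  by apply: (iso_SF_idempotent_eq SF); apply: finj; rewrite fM ?fx ?fy.
have S7_SF : has_sub_iso add mul s7_add s7_mul -> ~ iso_SF add mul.
  move=> [g [ginj [_ gM]]] SF.
  suff /ginj : g S7one = g S7inf by [].
  by apply: (iso_SF_idempotent_eq SF); rewrite -gM.
have [c [inf [c0 addf muli divc]]] := flat_structure HV SI.
have [HM2|[HS7 HSF1]|HSF] := chars_trichotomy HV c0 addf muli divc.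
- by split; [left; split; [|split; [exact: M2_S7|exact: M2_SF]] | move/(M2_S7 HM2)].
- split=> //; right; left; split; first by move/M2_S7.
  by split; [|exact: S7_SF].
- split; last by move/S7_SF.
  by right; right; split; [move/M2_SF | split; [move/S7_SF|]].
Qed.
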